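(* Let $\alpha$ be a unit-speed curve in Euclidean 3-space that is not a straight line, with alternative moving frame $\{N,C,W\}$ and alternative curvatures $f,g$, and let $S$ be the $C$-ruled surface $\varphi(s,v)=\alpha(s)+v\,C(s)$ with base curve $\alpha$. Then the geodesic curvature, the normal curvature and the geodesic torsion of the base curve $\alpha$ on $S$ can be given, respectively, as $$\kappa_g=0,\qquad \kappa_n=-f\cos\left(\int g\,ds\right),\qquad \tau_g=0.$$
   Context: Let $\alpha(s)$ be a regular curve in Euclidean 3-space parameterized by arc length $s$; the prime denotes $d/ds$. Its Frenet frame is $T=\alpha'$, $N=(1/\kappa)T'$, $B=T\times N$, with curvature $\kappa=\|T'\|>0$ and torsion $\tau=-\langle B',N\rangle$. The alternative moving frame $\{N,C,W\}$ consists of $N$, $C=N'/\|N'\|$ and $W=(\tau T+\kappa B)/\sqrt{\kappa^2+\tau^2}$; it satisfies $N'=fC$, $C'=-fN+gW$, $W'=-gC$, where the alternative curvatures are $f=\sqrt{\kappa^2+\tau^2}$ and $g=\frac{\kappa^2}{\kappa^2+\tau^2}\left(\frac{\tau}{\kappa}\right)'$. The notation $\int g\,ds$ denotes the antiderivative of $g$ equal to $\arctan(\tau/\kappa)$. The unit normal vector of a surface $\varphi(s,v)$ is defined by $n=\dfrac{\varphi_s\times\varphi_v}{\|\varphi_s\times\varphi_v\|}$. For a regular curve $\beta$ lying on a surface, with unit tangent vector $T_\beta$ and with $n_\beta$ the unit normal vector of the surface along $\beta$, the geodesic curvature, normal curvature and geodesic torsion of $\beta$ are defined by $$\kappa_g=\langle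 n_\beta\times T_\beta,\,T_\beta'\rangle,\qquad \kappa_n=\langle\beta'',n_\beta\rangle,\qquad \tau_g=\langle n_\beta\times n_\beta',\,T_\beta'\rangle.$$
   Formalization: The normal curvature formula is proved as printed where τ > 0 and with the opposite sign, κ_n = f cos(∫g ds), where τ < 0, since the printed sign fails there; points with τ = 0, where the surface is singular along α and its normal undefined, are excluded. *)

(* Defs.v *)
From mathcomp Require Import all_boot all_order all_algebra.
From mathcomp Require Import all_classical all_reals all_analysis.
Set Implicit Arguments.
Unset Strict Implicit.
Unset Printing Implicit Defensive.
Import Order.TTheory GRing.Theory Num.Theory.
Import numFieldNormedType.Exports.
Local Open Scope ring_scope.
Local Open Scope classical_set_scope.

Section Euclidean3.
Variable R : realType.
Implicit Types u v : 'rV[R]_3.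

Definition dot u v : R := \sum_(i < 3) u 0 i * v 0 i.

(* The norm [`|u|] that the library puts on row vectors is the sup norm. *)
Definition enorm u : R := Num.sqrt (dot u u).

(* Indices live in the cyclic group 'I_3 = Z/3, so that the i-th coordinate of
   u x v is u_(i+1) v_(i+2) - u_(i+2) v_(i+1). *)
Definition cross u v : 'rV[R]_3 :=
  \row_(i < 3) (u 0 (i + 1) * v 0 (i + 2%:R) - u 0 (i + 2%:R) * v 0 (i + 1)).

Definition unitv u : 'rV[R]_3 := (enorm u)^-1 *: u.

End Euclidean3.

Section Frames.
Variables (R : realType) (alpha : R -> 'rV[R]_3).

Definition frenetT : R -> 'rV[R]_3 := derive1 alpha.
Definition curvature (s : R) : R := enorm (derive1 frenetT s).
Definition frenetN (s : R) : 'rV[R]_3 := (curvature s)^-1 *: derive1 frenetT s.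
Definition frenetB (s : R) : 'rV[R]_3 := cross (frenetT s) (frenetN s).
Definition torsion (s : R) : R := - dot (derive1 frenetB s) (frenetN s).

Definition altC (s : R) : 'rV[R]_3 := unitv (derive1 frenetN s).
Definition altf (s : R) : R :=
  Num.sqrt (curvature s ^+ 2 + torsion s ^+ 2).
Definition altW (s : R) : 'rV[R]_3 :=
  (altf s)^-1 *:
  (torsion s *: frenetT s + curvature s *: frenetB s).
Definition altg (s : R) : R :=
  curvature s ^+ 2 / (curvature s ^+ 2 + torsion s ^+ 2) *
  derive1 (fun t => torsion t / curvature t) s.

(* [G] is the antiderivative of [altg] on [I] normalised to be atan (tau / kappa),
   which pins down the integration constant. *)
Definition is_int_altg (I : set R) (G : R -> R) : Prop :=
  forall s, I s ->
    is_derive s 1 G (altg s) /\ G s = atan (torsion s / curvature s).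

Definition C_ruled (s v : R) : 'rV[R]_3 := alpha s + v *: altC s.

(* Four derivatives are what is needed for [altg] to be meaningful;
   [0 < curvature] is what is needed for the Frenet frame to exist. *)
Definition unit_speed_frenet_curve (I : set R) : Prop :=
  [/\ open I, is_interval I,
      (forall k s, (k < 4)%N -> I s -> derivable (derive1n k alpha) s 1),
      (forall s, I s -> enorm (derive1 alpha s) = 1)
    & (forall s, I s -> 0 < curvature s)].

End Frames.

Section Surfaces.
Variables (R : realType) (phi : R -> R -> 'rV[R]_3).

Definition partial_s (s v : R) : 'rV[R]_3 := derive1 (phi ^~ v) s.
Definition partial_v (s v : R) : 'rV[R]_3 := derive1 (phi s) v.

Definition regular_point (s v : R) : Prop :=
  cross (partial_s s v) (partial_v s v) != 0.

(* Meaningful at regular points only. *)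
Definition unit_normal (s v : R) : 'rV[R]_3 :=
  unitv (cross (partial_s s v) (partial_v s v)).

End Surfaces.

(* [n] is the unit normal of the surface along the curve [beta]. *)
Section CurvesOnSurfaces.
Variables (R : realType) (n beta : R -> 'rV[R]_3).

Definition unit_tangent (s : R) : 'rV[R]_3 := unitv (derive1 beta s).
Definition geodesic_curvature (s : R) : R :=
  dot (cross (n s) (unit_tangent s)) (derive1 unit_tangent s).
Definition normal_curvature (s : R) : R := dot (derive1n 2 beta s) (n s).
Definition geodesic_torsion (s : R) : R :=
  dot (cross (n s) (derive1 n s)) (derive1 unit_tangent s).

End CurvesOnSurfaces.

(* Main.v *)
Require Import Defs.
From mathcomp Require Import all_boot all_order all_algebra.
From mathcomp Require Import all_classical all_reals all_analysis.
From mathcomp Require Import ring.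
Import Order.TTheory GRing.Theory Num.Theory.
Import numFieldNormedType.Exports.
Local Open Scope ring_scope.
Local Open Scope classical_set_scope.

(** The whole argument rests on the fact that the surface normal along the
    base curve is plus or minus the principal normal N.  On the base curve the
    tangent plane is spanned by T and C, and C is a positive multiple of N'.
    Since T' is parallel to N, differentiating B = T x N gives B' = T x N'; as
    both T and N' are orthogonal to N, this vector is parallel to N, and the
    definition of the torsion makes it - tau N ([cross_T_dN]).  Normalising,
    the surface normal is - sg(tau) N wherever the surface is regular
    ([unit_normal_base]); this is why the sign of the normal curvature depends
    on that of tau.

    Hence T' = kappa N is a multiple of the surface normal n.  The geodesic
    curvature and the geodesic torsion are inner products of T' with a vector
    of the form n x w, so both vanish, whatever the derivative of n is.  The
    normal curvature is <T', n> = - sg(tau) kappa, and kappa = f cos(int g)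
    because int g = arctan(tau / kappa) is the signed angle between the leg
    kappa and the hypotenuse f of the right triangle with legs kappa and tau
    ([altf_cos_atan]). *)

(** * Inner and cross products in coordinates *)

Section EuclideanAlgebra.
Variable R : realType.
Implicit Types (u v w : 'rV[R]_3) (a : R).

Lemma dotE u v :
  dot u v = u 0 0 * v 0 0 + u 0 1 * v 0 1 + u 0 2%:R * v 0 2%:R.
Proof.
rewrite /dot !big_ord_recl big_ord0 addr0 addrA.
by do !congr (_ + _); congr (u 0 _ * v 0 _); apply/val_inj.
Qed.

Lemma crossE u v :
  (cross u v 0 0 = u 0 1 * v 0 2%:R - u 0 2%:R * v 0 1) *
  (cross u v 0 1 = u 0 2%:R * v 0 0 - u 0 0 * v 0 2%:R) *
  (cross u v 0 2%:R = u 0 0 * v 0 1 - u 0 1 * v 0 0).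
Proof.
have e11 : (1 + 1 = 2%:R :> 'I_3) by apply/val_inj.
have e12 : (1 + 2%:R = 0 :> 'I_3) by apply/val_inj.
have e21 : (2%:R + 1 = 0 :> 'I_3) by apply/val_inj.
have e22 : (2%:R + 2%:R = 1 :> 'I_3) by apply/val_inj.
by split; [split|]; rewrite !mxE ?add0r ?e11 ?e12 ?e21 ?e22.
Qed.

(** Unlike [mxE], this leaves [cross] folded, so that [crossE] can apply. *)
Lemma coordE i :
  (forall u v, (u + v) 0 i = u 0 i + v 0 i) *
  (forall u, (- u) 0 i = - u 0 i) *
  (forall a u, (a *: u) 0 i = a * u 0 i).
Proof. by split; [split|]=> *; rewrite mxE. Qed.

Lemma row3P u v :
  u 0 0 = v 0 0 -> u 0 1 = v 0 1 -> u 0 2%:R = v 0 2%:R -> u = v.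
Proof.
move=> e0 e1 e2; apply/rowP => -[[|[|[|//]]] hi].
- by rewrite (_ : Ordinal hi = 0)//; apply/val_inj.
- by rewrite (_ : Ordinal hi = 1)//; apply/val_inj.
- by rewrite (_ : Ordinal hi = 2%:R)//; apply/val_inj.
Qed.

Lemma dotC u v : dot u v = dot v u.
Proof. by rewrite !dotE; ring. Qed.

Lemma dotZl a u v : dot (a *: u) v = a * dot u v.
Proof. by rewrite !dotE !mxE; ring. Qed.

Lemma dotZr a u v : dot u (a *: v) = a * dot u v.
Proof. by rewrite dotC dotZl dotC. Qed.

Lemma crossZl a u v : cross (a *: u) v = a *: cross u v.
Proof. by apply: row3P; rewrite !(coordE, crossE); ring. Qed.

Lemma crossZr a u v : cross u (a *: v) = a *: cross u v.
Proof. by apply: row3P; rewrite !(coordE, crossE); ring. Qed.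

Lemma crossvv u : cross u u = 0.
Proof. by apply: row3P; rewrite [RHS]mxE crossE; ring. Qed.

Lemma dot_cross_self u v : dot (cross u v) u = 0.
Proof. by rewrite dotE !crossE; ring. Qed.

(** The triple product expansion of w x ((u x v) x w), computed in two ways:
    the left and first right terms come from expanding the outer product, the
    remaining ones from expanding the inner one. *)
Lemma cross_decomp u v w :
  dot w w *: cross u v =
  dot (cross u v) w *: w + dot u w *: cross w v - dot v w *: cross w u.
Proof. by apply: row3P; rewrite !(coordE, crossE, dotE); ring. Qed.

Lemma cross_orthogonal u v w :
  dot w w = 1 -> dot u w = 0 -> dot v w = 0 ->
  cross u v = dot (cross u v) w *: w.
Proof.
move=> ww uw vw; have := cross_decomp u v w.
by rewrite ww uw vw !scale0r subr0 addr0 scale1r.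
Qed.

Lemma dot_ge0 u : 0 <= dot u u.
Proof. by rewrite /dot sumr_ge0// => i _; rewrite -expr2 sqr_ge0. Qed.

Lemma enorm_sqr u : enorm u ^+ 2 = dot u u.
Proof. by rewrite sqr_sqrtr ?dot_ge0. Qed.

Lemma enorm_ge0 u : 0 <= enorm u.
Proof. exact: sqrtr_ge0. Qed.

Lemma enormZ a u : enorm (a *: u) = `|a| * enorm u.
Proof.
by rewrite /enorm dotZl dotZr mulrA -expr2 sqrtrM ?sqr_ge0// sqrtr_sqr.
Qed.

Lemma unitv_id u : enorm u = 1 -> unitv u = u.
Proof. by move=> u1; rewrite /unitv u1 invr1 scale1r. Qed.

Lemma unitvZ a u : enorm u = 1 -> unitv (a *: u) = Num.sg a *: u.
Proof.
move=> u1; rewrite /unitv enormZ u1 mulr1 scalerA; congr (_ *: _).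
have [->|a0] := eqVneq a 0; first by rewrite sgr0 mulr0.
by rewrite [X in _ * X]numEsg mulrCA mulVf ?mulr1 ?normr_eq0.
Qed.

End EuclideanAlgebra.

(** * Product rules *)

Section ProductRules.
Variable R : realType.
Implicit Types (u v : R -> 'rV[R]_3) (s : R).

Lemma is_derive_coord u s i j :
  derivable u s 1 -> is_derive s 1 (fun t => u t i j) (derive1 u s i j).
Proof.
move=> du; rewrite derive1E derive_mx// mxE.
by apply: derivableP; move/derivable_mxP: du; exact.
Qed.

Lemma derive1_eq_near (V : normedModType R) (f h : R -> V) s :
  (\near s, f s = h s) -> derive1 f s = derive1 h s.
Proof. by move=> fh; rewrite !derive1E; exact: near_eq_derive. Qed.

Lemma is_derive_dot u v s : derivable u s 1 -> derivable v s 1 ->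
  is_derive s 1 (fun t => dot (u t) (v t))
    (dot (derive1 u s) (v s) + dot (u s) (derive1 v s)).
Proof.
move=> du dv.
have Du i := @is_derive_coord u s 0 i du.
have Dv i := @is_derive_coord v s 0 i dv.
rewrite (_ : (fun t => _) = (fun t => u t 0 0 * v t 0 0) +
   (fun t => u t 0 1 * v t 0 1) + (fun t => u t 0 2%:R * v t 0 2%:R)).
  apply: (@is_derive_eq); rewrite !dotE.
  rewrite /GRing.scale/=; ring.
by apply/funext => t; rewrite dotE.
Qed.

Lemma derivable_cross u v s : derivable u s 1 -> derivable v s 1 ->
  derivable (fun t => cross (u t) (v t)) s 1.
Proof.
move=> du dv; apply/derivable_mxP => i j.
rewrite (_ : (fun t => _) = (fun t => u t 0 (j + 1) * v t 0 (j + 2%:R)) -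
   (fun t => u t 0 (j + 2%:R) * v t 0 (j + 1))); last first.
  by apply/funext => t; rewrite mxE.
by apply: derivableB; apply: derivableM; apply: ex_derive; exact: is_derive_coord.
Qed.

Lemma derive1_cross u v s : derivable u s 1 -> derivable v s 1 ->
  derive1 (fun t => cross (u t) (v t)) s =
  cross (derive1 u s) (v s) + cross (u s) (derive1 v s).
Proof.
move=> du dv; rewrite [LHS]derive1E derive_mx; last exact: derivable_cross.
apply/rowP => j; rewrite 3!mxE.
have Du i := @is_derive_coord u s 0 i du.
have Dv i := @is_derive_coord v s 0 i dv.
rewrite (_ : (fun t => _) = (fun t => u t 0 (j + 1) * v t 0 (j + 2%:R)) -
   (fun t => u t 0 (j + 2%:R) * v t 0 (j + 1))); last first.
  by apply/funext => t; rewrite mxE.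
rewrite derive_val !mxE /GRing.scale/=; ring.
Qed.

Lemma derivable_scale (k : R -> R) u s : derivable k s 1 -> derivable u s 1 ->
  derivable (fun t => k t *: u t) s 1.
Proof.
move=> dk du; apply/derivable_mxP => i j.
rewrite (_ : (fun t => _) = k * (fun t => u t i j)); last first.
  by apply/funext => t; rewrite mxE.
by apply: derivableM => //; apply: ex_derive; exact: is_derive_coord.
Qed.

Lemma derivable_enorm u s : derivable u s 1 -> 0 < enorm (u s) ->
  derivable (fun t => enorm (u t)) s 1.
Proof.
move=> du; rewrite sqrtr_gt0 => u_gt0.
have := @is_derive_dot u u s du du => Du.
have Ds : is_derive (dot (u s) (u s)) 1 Num.sqrt
   (2 * Num.sqrt (dot (u s) (u s)))^-1 by exact: is_derive1_sqrt.
apply: ex_derive; exact: (@is_derive1_comp _ Num.sqrt (fun t => dot (u t) (u t))).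
Qed.

(** Differentiating <u, u> = 1 gives 2 <u', u> = 0. *)
Lemma dot_derive1_eq0 u s : derivable u s 1 -> (\near s, enorm (u s) = 1) ->
  dot (derive1 u s) (u s) = 0.
Proof.
move=> du u1; have Du := @is_derive_dot u u s du du.
have : derive1 (fun t => dot (u t) (u t)) s = 0.
  rewrite (@derive1_eq_near R _ (cst (1 : R))) ?derive1_cst//.
  by near=> t; rewrite -enorm_sqr (near u1 t)// expr1n.
rewrite derive1E derive_val [X in _ + X]dotC -mulr2n => /eqP.
by rewrite mulrn_eq0/= => /eqP.
Unshelve. all: by end_near. Qed.

End ProductRules.

(** * The Frenet frame and the normal of the C-ruled surface *)

Section BaseCurve.
Variables (R : realType) (I : set R) (alpha : R -> 'rV[R]_3).
Hypothesis halpha : unit_speed_frenet_curve alpha I.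
Variable s : R.
Hypothesis Is : I s.

Local Notation T := (frenetT alpha).
Local Notation N := (frenetN alpha).
Local Notation B := (frenetB alpha).
Local Notation kappa := (curvature alpha).
Local Notation tau := (torsion alpha).

Lemma near_interval : \forall t \near s, I t.
Proof. by case: halpha => oI _ _ _ _; exact: open_nbhs_nbhs. Qed.

Lemma curvature_gt0 : 0 < kappa s.
Proof. by case: halpha => _ _ _ _; exact. Qed.

Lemma derivable_T : derivable T s 1.
Proof. by case: halpha => _ _ /(_ 1%N s isT Is). Qed.

Lemma derivable_dT : derivable (derive1 T) s 1.
Proof. by case: halpha => _ _ /(_ 2%N s isT Is). Qed.

Lemma derivable_N : derivable N s 1.
Proof.
apply: derivable_scale; last exact: derivable_dT.
apply: derivableV; first by rewrite gt_eqF// curvature_gt0.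
by apply: derivable_enorm; [exact: derivable_dT|exact: curvature_gt0].
Qed.

Lemma derive1_T : derive1 T s = kappa s *: N s.
Proof. by rewrite /frenetN scalerA divff ?scale1r// gt_eqF// curvature_gt0. Qed.

Lemma near_enorm_T : \near s, enorm (T s) = 1.
Proof.
case: halpha => _ _ _ h1 _; near=> t; apply: h1.
exact: (near near_interval t).
Unshelve. all: by end_near. Qed.

Lemma near_enorm_N : \near s, enorm (N s) = 1.
Proof.
case: halpha => _ _ _ _ hk; near=> t.
have k0 : 0 < kappa t by apply: hk; exact: (near near_interval t).
rewrite /frenetN enormZ gtr0_norm ?invr_gt0//.
by rewrite -/(curvature alpha t) mulVf ?gt_eqF.
Unshelve. all: by end_near. Qed.

Lemma enorm_N : enorm (N s) = 1.
Proof. exact: nbhs_singleton near_enorm_N. Qed.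

Lemma dot_N_N : dot (N s) (N s) = 1.
Proof. by rewrite -enorm_sqr enorm_N expr1n. Qed.

Lemma dot_T_N : dot (T s) (N s) = 0.
Proof.
have /eqP := @dot_derive1_eq0 _ T s derivable_T near_enorm_T.
rewrite derive1_T dotZl mulf_eq0 gt_eqF ?curvature_gt0//= => /eqP <-.
exact: dotC.
Qed.

(** Both sides are B': the left one by the product rule on T x N, as T' x N
    vanishes, and the right one by the definition of the torsion, as T x N' is
    parallel to N. *)
Lemma cross_T_dN : cross (T s) (derive1 N s) = - torsion alpha s *: N s.
Proof.
have dB : derive1 B s = cross (T s) (derive1 N s).
  rewrite (derive1_cross _ _ _ _ derivable_T derivable_N) derive1_T.
  by rewrite crossZl crossvv scaler0 add0r.
rewrite (cross_orthogonal _ _ _ _ dot_N_N dot_T_N); last first.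
  exact: dot_derive1_eq0 derivable_N near_enorm_N.
by rewrite -dB /torsion opprK.
Qed.

Lemma partial_s_base : partial_s (C_ruled alpha) s 0 = T s.
Proof.
rewrite /partial_s /frenetT; congr (derive1 _ s).
by apply/funext => t; rewrite /C_ruled scale0r addr0.
Qed.

Lemma partial_v_base : partial_v (C_ruled alpha) s 0 = altC alpha s.
Proof.
have phiE i j : (fun t => C_ruled alpha s t i j) =
    cst (alpha s i j) + altC alpha s i j *: (id : R -> R).
  by apply/funext => t; rewrite !mxE mulrC.
have dphi : derivable (C_ruled alpha s) 0 1.
  by apply/derivable_mxP => i j; rewrite phiE.
rewrite /partial_v derive1E derive_mx//; apply/rowP => j.
by rewrite mxE phiE derive_val add0r /GRing.scale/= mulr1.
Qed.

(** Where the surface is regular, N' is nonzero, so normalising it to C does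
    not affect the direction of T x C. *)
Lemma unit_normal_base : regular_point (C_ruled alpha) s 0 ->
  unit_normal (C_ruled alpha) s 0 = - Num.sg (tau s) *: N s.
Proof.
rewrite /regular_point /unit_normal partial_s_base partial_v_base.
rewrite /altC /unitv crossZr cross_T_dN scalerA -/(unitv _) => reg.
have dN_gt0 : 0 < enorm (derive1 N s).
  rewrite lt_neqAle enorm_ge0 eq_sym andbT.
  by apply: contraNneq reg => ->; rewrite invr0 mul0r scale0r.
by rewrite unitvZ ?enorm_N// sgrM gtr0_sg ?invr_gt0// mul1r sgrN.
Qed.

Lemma derive1_unit_tangent :
  derive1 (unit_tangent alpha) s = kappa s *: N s.
Proof.
rewrite -derive1_T; apply: derive1_eq_near; near=> t.
by rewrite /unit_tangent unitv_id//; near: t; exact: near_enorm_T.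
Unshelve. all: by end_near. Qed.

Lemma altf_cos_atan : altf alpha s * cos (atan (tau s / kappa s)) = kappa s.
Proof.
have k0 := curvature_gt0.
have p0 : 0 < 1 + (tau s / kappa s) ^+ 2 by rewrite ltr_pwDl// sqr_ge0.
rewrite cos_atan /altf.
rewrite (_ : kappa s ^+ 2 + _ = kappa s ^+ 2 * (1 + (tau s / kappa s) ^+ 2)).
  rewrite sqrtrM ?sqr_ge0// sqrtr_sqr gtr0_norm// mulfK//.
  by rewrite gt_eqF// sqrtr_gt0.
by field; rewrite gt_eqF.
Qed.

End BaseCurve.

Theorem theorem3p10 (R : realType) (I : set R) (alpha : R -> 'rV[R]_3)
    (intg : R -> R)
    (halpha : unit_speed_frenet_curve alpha I)
    (hintg : is_int_altg alpha I intg) :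
  let n := fun s : R => unit_normal (C_ruled alpha) s 0 in
  forall s : R, I s -> regular_point (C_ruled alpha) s 0 ->
  [/\ geodesic_curvature n alpha s = 0,
      (0 < torsion alpha s ->
         normal_curvature n alpha s = - altf alpha s * cos (intg s)) /\
      (torsion alpha s < 0 ->
         normal_curvature n alpha s = altf alpha s * cos (intg s))
    & geodesic_torsion n alpha s = 0].
Proof.
move=> n s Is reg.
have nE : n s = - Num.sg (torsion alpha s) *: frenetN alpha s.
  exact: (unit_normal_base _ _ _ halpha _ Is reg).
have dtE := derive1_unit_tangent _ _ _ halpha _ Is.
have knE : normal_curvature n alpha s =
    - Num.sg (torsion alpha s) * curvature alpha s.
  rewrite /normal_curvature nE [derive1n _ _ _](derive1_T _ _ _ halpha _ Is).
  by rewrite dotZl dotZr (dot_N_N _ _ _ halpha _ Is) mulr1 mulrC.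
have fE : altf alpha s * cos (intg s) = curvature alpha s.
  by rewrite (hintg s Is).2 (altf_cos_atan _ _ _ halpha _ Is).
split.
- by rewrite /geodesic_curvature dtE nE crossZl dotZl dotZr dot_cross_self !mulr0.
- by split=> t0; rewrite knE -fE ?(gtr0_sg t0) ?(ltr0_sg t0); ring.
- by rewrite /geodesic_torsion dtE nE crossZl dotZl dotZr dot_cross_self !mulr0.
Qed.
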